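(* For every prime power $p$ and every positive integer $m$ there is an $r$-uniform, $r$-partite hypergraph with $r=p+2$, which is regular of degree $d=p^2m$, in which the number of vertices in each of the $r$ vertex classes is $pm$ (hence the total number of vertices is $n=p(p+2)m$), there are no multiple edges, and the maximum size of a matching is $m$; namely, a maximum matching covers only a $1/p=1/(r-2)$ fraction of the vertices.
   Context: An $r$-uniform $r$-partite hypergraph is one whose vertex set is partitioned into $r$ classes such that each edge consists of exactly one vertex from each class. Regular of degree $d$ means that every vertex lies in exactly $d$ edges. A matching is a set of pairwise disjoint edges. *)

(* Defs.v *)
From mathcomp Require Import all_boot.

Set Implicit Arguments.
Unset Strict Implicit.
Unset Printing Implicit Defensive.

(* Edges are indexed by a type of their own, so that the same set of vertices
   may occur several times as an edge; [simple_hypergraph] excludes this. *)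
Record hypergraph := Hypergraph {
  vertex : finType;
  edge : finType;
  ends : edge -> {set vertex}
}.

Section HypergraphNotions.

Variable H : hypergraph.

Definition simple_hypergraph : Prop := injective (@ends H).

Definition uniform (r : nat) : Prop := forall e : edge H, #|ends e| = r.

(* As [partition] requires it, the classes in [P] are nonempty and pairwise
   disjoint, so that [#|P|] is the number of classes. *)
Definition partite (r : nat) (P : {set {set vertex H}}) : Prop :=
  [/\ partition P [set: vertex H],
      #|P| = r
    & forall (e : edge H) (C : {set vertex H}), C \in P -> #|ends e :&: C| = 1].

Definition degree (v : vertex H) : nat := #|[set e : edge H | v \in ends e]|.

Definition regular (d : nat) : Prop := forall v : vertex H, degree v = d.

Definition matching (M : {set edge H}) : bool :=
  [forall e in M, forall f in M, (e != f) ==> [disjoint ends e & ends f]].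

Definition matching_number : nat :=
  \max_(M : {set edge H} | matching M) #|M|.

Definition maximum_matching (M : {set edge H}) : bool :=
  matching M && (#|M| == matching_number).

Definition covered (M : {set edge H}) : {set vertex H} :=
  \bigcup_(e in M) ends e.

End HypergraphNotions.

Definition prime_power (p : nat) : Prop :=
  exists q k : nat, [/\ prime q, 0 < k & p = q ^ k].

(* Main.v *)
Require Import Defs.
From mathcomp Require Import all_boot all_order all_algebra all_field.
Import GRing.Theory.

Set Implicit Arguments.
Unset Strict Implicit.
Unset Printing Implicit Defensive.

(** For m = 1 the edges are the p^3 points (x, y, z) of F^3, |F| = p, and the
    vertex classes are p + 2 linear forms on F^3: the p + 1 forms x + t y and
    y, at least one of which vanishes at any given vector, and z. These points
    of the dual plane are a blocking set, a line plus one point. Hence two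
    edges always agree in one of the first p + 1 classes, while z keeps them
    distinct. For general m the vertices are copied m times; an edge chooses
    one copy i for the first p + 1 classes and an independent copy j for the
    last class. Edges with the same i meet, so a matching has at most m edges,
    and the edges through x = y = z = 0 with i = j form a matching of size m. *)

Section CoordinateHypergraph.

Variables (I S E : finType) (f : I -> E -> S).

(** A vertex is a class paired with a value, and an edge is the graph of [c |-> f c e], so it has
    one vertex in each class by construction. *)
Definition coordinate_ends (e : E) : {set I * S} := [set v | v.2 == f v.1 e].

Definition coordinate_hypergraph : hypergraph := Hypergraph coordinate_ends.

Definition coordinate_class (c : I) : {set I * S} := [set v | v.1 == c].

Definition coordinate_classes : {set {set I * S}} :=
  [set coordinate_class c | c : I].

Lemma coordinate_endsE e : coordinate_ends e = [set (c, f c e) | c : I].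
Proof.
apply/setP=> -[c s]; rewrite inE /=; apply/eqP/imsetP=> [->|[c' _ [-> ->]]] //.
by exists c.
Qed.

Lemma coordinate_uniform : uniform coordinate_hypergraph #|I|.
Proof. by move=> e; rewrite /= coordinate_endsE card_imset // => c c' []. Qed.

Lemma card_coordinate_class c : #|coordinate_class c| = #|S|.
Proof.
have ->: coordinate_class c = setX [set c] [set: S].
  by apply/setP=> -[c' s]; rewrite !inE andbT.
by rewrite cardsX cards1 cardsT mul1n.
Qed.

(** The point [s0] keeps the classes nonempty; with [S] empty they would all coincide. *)
Lemma coordinate_class_inj (s0 : S) : injective coordinate_class.
Proof. by move=> c c' /setP/(_ (c, s0)); rewrite !inE eqxx => /esym/eqP. Qed.

Lemma coordinate_partite (s0 : S) :
  partite (H := coordinate_hypergraph) #|I| coordinate_classes.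
Proof.
split.
- apply/and3P; split.
  + apply/eqP/setP=> v; rewrite inE; apply/bigcupP.
    by exists (coordinate_class v.1); rewrite ?imset_f // inE.
  + apply/trivIsetP=> _ _ /imsetP[c _ ->] /imsetP[c' _ ->] ne.
    apply/pred0P=> v /=; rewrite !inE; apply/negP=> /andP[/eqP vc /eqP vc'].
    by move/eqP: ne; apply; rewrite -vc -vc'.
  + apply/imsetP=> -[c _ /setP/(_ (c, s0))].
    by rewrite !inE eqxx.
- by rewrite card_imset //; apply: coordinate_class_inj.
- move=> e _ /imsetP[c _ ->]; rewrite /=.
  have ->: coordinate_ends e :&: coordinate_class c = [set (c, f c e)].
    apply/setP=> -[c' s]; rewrite !inE xpair_eqE /= andbC.
    by case: eqP => // ->.
  by rewrite cards1.
Qed.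

Lemma coordinate_degree c s :
  degree (H := coordinate_hypergraph) (c, s) = #|[set e | f c e == s]|.
Proof.
by rewrite /degree; apply: eq_card => e; rewrite !inE /= eq_sym.
Qed.

Lemma coordinate_simple :
  (forall e e', (forall c, f c e = f c e') -> e = e') ->
  simple_hypergraph coordinate_hypergraph.
Proof.
move=> sep e e' /setP ee'; apply: sep => c.
by have := ee' (c, f c e); rewrite !inE eqxx /= => /esym/eqP.
Qed.

Lemma coordinate_disjointP e e' :
  reflect (forall c, f c e <> f c e')
          [disjoint coordinate_ends e & coordinate_ends e'].
Proof.
apply: (iffP pred0P) => [dis c fc | ne [c s] /=].
  by have := dis (c, f c e); rewrite /= !inE /= fc eqxx.
by rewrite !inE /=; apply/andP=> -[/eqP -> /eqP]; apply: ne.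
Qed.

End CoordinateHypergraph.

Lemma card_covered (H : hypergraph) r (M : {set edge H}) :
  uniform H r -> matching M -> #|covered M| = #|M| * r.
Proof.
move=> unif /forall_inP mM.
(* The union is extended to all edges, with the empty set outside [M], so that any two distinct
   indices give disjoint sets. *)
rewrite /covered big_mkcond -sum1_card partition_disjoint_bigcup => [|e f ne].
  rewrite -sum_nat_const [RHS]big_mkcond; apply: eq_bigr => e _.
  by case: ifP => _; rewrite sum1_card ?cards0.
case: ifP => eM; last by rewrite disjoints_subset sub0set.
case: ifP => fM; last by rewrite disjoint_sym disjoints_subset sub0set.
by have /forall_inP/(_ f fM)/implyP/(_ ne) := mM e eM.
Qed.

Section BlockingSetHypergraph.

Variables (F : finFieldType) (m : nat).
Local Open Scope ring_scope.

(** An edge is [((x, y, i), (z, j))]; the second component is itself its vertex in the last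
    class. *)
Definition bs_edge : finType := ((F * F * 'I_m) * (F * 'I_m))%type.

(* [Some (Some t)] is the form x + t y, [Some None] is y and [None] is z. *)
Definition bs_coord (c : option (option F)) (e : bs_edge) : F * 'I_m :=
  let: ((x, y, i), w) := e in
  match c with
  | Some (Some t) => (x + t * y, i)
  | Some None => (y, i)
  | None => w
  end.

Definition bs_hypergraph := coordinate_hypergraph bs_coord.

Lemma bs_coord_meet x y i w x' y' w' :
  exists c, bs_coord c ((x, y, i), w) = bs_coord c ((x', y', i), w').
Proof.
have [<-|ne] := eqVneq y y'; first by exists (Some None).
(* This slope is the solution [t] of [x + t * y = x' + t * y']. *)
exists (Some (Some ((x' - x) / (y - y')))) => /=; congr (_, _).
have nz : y - y' != 0 by rewrite subr_eq0.
apply/eqP; rewrite -subr_eq0 opprD addrACA -mulrBr divfK //.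
by rewrite -(opprB x x') subrr.
Qed.

Lemma bs_simple : simple_hypergraph bs_hypergraph.
Proof.
apply: coordinate_simple => -[[[x y] i] w] [[[x' y'] i'] w'] same.
have /= -> := same None.
have /= [-> ->] := same (Some None).
(* The form with [t = 0] is [x]. *)
by have /= [] := same (Some (Some 0)); rewrite !mul0r !addr0 => ->.
Qed.

Lemma bs_regular : regular bs_hypergraph (#|F| ^ 2 * m).
Proof.
case=> c [s i]; rewrite coordinate_degree.
(* A vertex in one of the first p + 1 classes fixes [i] and puts [(x, y)] on an affine line,
   parametrised by [g]; the last component stays free. *)
have card_section (g : F -> F * F) : injective g ->
    #|[set ((g u.1, i), u.2) | u : F * (F * 'I_m)] : {set bs_edge}|
    = (#|F| ^ 2 * m)%N.
  move=> g_inj; rewrite card_imset; last first.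
    by move=> [u w] [u' w'] /= [/g_inj -> ->].
  by rewrite !card_prod card_ord mulnA.
case: c => [[t|]|].
- rewrite -(card_section (fun y => (s - t * y, y))); last by move=> y y' [].
  apply: eq_card => -[[[x y] j] w]; rewrite inE /=.
  apply/eqP/imsetP => [[<- <-]|[[u v] _ [-> -> -> _]]]; last by rewrite subrK.
  by exists (y, w); rewrite //= addrK.
- rewrite -(card_section (fun x => (x, s))); last by move=> x x' [].
  apply: eq_card => -[[[x y] j] w]; rewrite inE /=.
  apply/eqP/imsetP => [[<- <-]|[[u v] _ [_ -> -> _]]] //.
  by exists (x, w).
- have ->: [set e | bs_coord None e == (s, i)]
           = setX [set: F * F * 'I_m] [set (s, i)].
    by apply/setP=> -[[[x y] j] w]; rewrite !inE.
  by rewrite cardsX cards1 cardsT !card_prod card_ord muln1.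
Qed.

Lemma bs_matching_number : matching_number bs_hypergraph = m.
Proof.
apply/eqP; rewrite eqn_leq; apply/andP; split.
  apply/bigmax_leqP => M /forall_inP mM.
  (* The copy index [i] is injective on a matching, since edges sharing it meet. *)
  rewrite -[leqRHS]card_ord -(card_in_imset (f := fun e : bs_edge => e.1.2)).
    exact: max_card.
  move=> e e' eM e'M; have /forall_inP/(_ e' e'M)/implyP := mM e eM.
  case: e {eM} => -[[x y] i] w; case: e' {e'M} => -[[x' y'] i'] w' /= dis ii'.
  rewrite -{i'}ii' in dis *; apply/eqP/negP=> /negP/dis.
  move/coordinate_disjointP; have [c eq_c] := bs_coord_meet x y i w x' y' w'.
  by move/(_ c).
pose D : {set bs_edge} := [set ((0, 0, i), (0, i)) | i : 'I_m].
have cardD : #|D| = m by rewrite card_imset ?card_ord // => i j [].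
rewrite -{1}cardD; apply: (leq_bigmax_cond (F := fun M : {set bs_edge} => #|M|)).
apply/forall_inP => _ /imsetP[i _ ->]; apply/forall_inP => _ /imsetP[j _ ->].
apply/implyP=> /eqP ne; apply/coordinate_disjointP => c eq_c; apply: ne.
(* Every vertex of a diagonal edge carries its copy index, so a common vertex forces [i = j]. *)
by suff ->: i = j by []; case: c eq_c => [[t|]|] [].
Qed.

End BlockingSetHypergraph.

Unset Implicit Arguments.

Theorem claim5p1 (p m : nat) (hp : prime_power p) (hm : 0 < m) :
  let r := p + 2 in
  let d := p ^ 2 * m in
  exists (H : hypergraph) (P : {set {set vertex H}}),
    [/\ uniform H r, partite r P & regular H d] /\
    [/\ forall C : {set vertex H}, C \in P -> #|C| = p * m,
        #|vertex H| = p * (p + 2) * m,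
        simple_hypergraph H
      & matching_number H = m] /\
    (forall M : {set edge H}, maximum_matching M ->
      (#|covered M|%:R / #|vertex H|%:R = 1 / p%:R :> rat)%R /\
      (1 / p%:R = 1 / (r%:R - 2%:R) :> rat)%R).
Proof.
move=> r d; have [q [k [q_pr k_gt0 pE]]] := hp.
have [F _ cardF] := pPrimePowerField q_pr k_gt0.
have {q k q_pr k_gt0 pE}cardF : #|F| = p by rewrite cardF.
pose i0 : 'I_m := Ordinal hm.
have cardI : #|{: option (option F)}| = r by rewrite !card_option cardF /r addn2.
have unif : uniform (bs_hypergraph F m) r.
  by rewrite -cardI; apply: coordinate_uniform.
have cardV : #|vertex (bs_hypergraph F m)| = p * (p + 2) * m.
  by rewrite /= card_prod cardI card_prod cardF card_ord /r mulnCA mulnA.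
have p_neq0 : (p%:R != 0 :> rat)%R.
  by rewrite Num.Theory.pnatr_eq0 -cardF -lt0n; apply/card_gt0P; exists 0%R.
exists (bs_hypergraph F m), (coordinate_classes _ _); split; last split.
- split=> //; last by rewrite /d -cardF; apply: bs_regular.
  by rewrite -cardI; apply: coordinate_partite (0%R, i0).
- split=> //; [|exact: bs_simple|exact: bs_matching_number].
  move=> _ /imsetP[c _ ->].
  by rewrite card_coordinate_class card_prod cardF card_ord.
- move=> M /andP[mM /eqP maxM]; rewrite bs_matching_number in maxM.
  split; last by rewrite /r natrD addrK.
  (* The covered vertices number [m * r] out of [p * (m * r)]. *)
  rewrite cardV (card_covered unif mM) maxM -mulnA [r * m]mulnC.
  have mr_neq0 : ((m * r)%:R != 0 :> rat)%R.
    by rewrite Num.Theory.pnatr_eq0 muln_eq0 negb_or -!lt0n hm /r addn2.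
  by rewrite (natrM _ p) invfM mulrCA divff // mulr1 div1r.
Qed.
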